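(* Let $a_1,a_2\in W$ be the elements determined by $a_1=(a_2,1)\,\sigma$ and $a_2=(a_1,1)$, and let $G=\overline{\langle a_1,a_2\rangle}\subset W$ be the closed subgroup they topologically generate. For any elements $b_1,b_2\in W$ the following are equivalent: (a) $b_1$ is conjugate to $(b_2,1)\,\sigma$ under $W$, and $b_2$ is conjugate to $(b_1,1)$ under $W$. (b) $b_i$ is conjugate to $a_i$ under $W$ for $i=1,2$. (c) There exist $w\in W$ and $x_1,x_2\in G$ such that $b_i=(wx_i)a_i(wx_i)^{-1}$ for $i=1,2$. (d) There exists $w\in W$ such that $b_1=wa_1w^{-1}$ and $b_2=wa_2w^{-1}$.
   Context: $T$ is the infinite rooted binary tree whose vertices are the finite words over $\{0,1\}$, with root the empty word, each word $t$ being joined by an edge to $t0$ and $t1$. $W:=\operatorname{Aut}(T)$ is its automorphism group, a profinite group as the inverse limit of the finite groups $W_n=\operatorname{Aut}(T_n)$, where $T_n\subset T$ is the subtree of words of length $\le n$. For $u,v\in W$, $(u,v)\in W$ denotes the automorphism $0t\mapsto 0\,u(t)$, $1t\mapsto 1\,v(t)$ for all words $t$; $\sigma\in W$ is the automorphism of order $2$ with $0t\mapsto 1t$ and $1t\mapsto 0t$. Thus $W=(W\times W)\rtimes\langle\sigma\rangle$. The recursion relations for $a_1,a_2$ have a unique solution in $W$. *)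

(* Defs.v *)
From HB Require Import structures.
From mathcomp Require Import all_boot.
From mathcomp Require Import boolp classical_sets topology.

Set Implicit Arguments.
Unset Strict Implicit.
Unset Printing Implicit Defensive.

Local Open Scope classical_set_scope.
Local Open Scope group_scope.

(* The letters 0 and 1 are [false] and [true]; [::] is the root of T.  A word
   is read from the root, so the letter added in passing from t to a child is
   appended on the right. *)
Definition word := seq bool.

Definition edge (s t : word) : bool :=
  [exists x : bool, (t == rcons s x) || (s == rcons t x)].

Record W := Automorphism {
  aut_fun :> word -> word;
  aut_bij : bijective aut_fun;
  aut_root : aut_fun [::] = [::];
  aut_edge : {mono aut_fun : s t / edge s t}
}.

Lemma aut_ext (u v : W) : u =1 v -> u = v.
Proof.
case: u v => [f fb fr fe] [g gb gr ge] /= /funext fg.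
by subst g; congr Automorphism; apply: Prop_irrelevance.
Qed.

HB.instance Definition _ := gen_eqMixin W.
HB.instance Definition _ := gen_choiceMixin W.

Definition aut_one : W := @Automorphism id
  (Bijective (fun=> erefl) (fun=> erefl)) erefl (fun _ _ => erefl).

Lemma aut_mul_root (u v : W) : (u \o v) [::] = [::].
Proof. by rewrite /= !aut_root. Qed.

Lemma aut_mul_edge (u v : W) : {mono u \o v : s t / edge s t}.
Proof. by move=> s t /=; rewrite !aut_edge. Qed.

Definition aut_mul (u v : W) : W := @Automorphism (u \o v)
  (bij_comp (aut_bij u) (aut_bij v)) (aut_mul_root u v) (@aut_mul_edge u v).

Lemma aut_inv_exists (u : W) : exists v : W, cancel u v /\ cancel v u.
Proof.
have [g uK gK] := aut_bij u.
have gr : g [::] = [::] by rewrite -{1}(aut_root u) uK.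
have ge : {mono g : s t / edge s t} by move=> s t; rewrite -(aut_edge u) !gK.
exists (@Automorphism g (Bijective gK uK) gr ge); split; [exact: uK|exact: gK].
Qed.

Definition aut_inv (u : W) : W := projT1 (cid (aut_inv_exists u)).

Lemma aut_invK (u : W) : cancel u (aut_inv u).
Proof. by rewrite /aut_inv; case: cid => v []. Qed.

Lemma aut_invKV (u : W) : cancel (aut_inv u) u.
Proof. by rewrite /aut_inv; case: cid => v []. Qed.

Lemma aut_mulA : associative aut_mul.
Proof. by move=> u v w; apply: aut_ext. Qed.

Lemma aut_mul1 : left_id aut_one aut_mul.
Proof. by move=> u; apply: aut_ext. Qed.

Lemma aut_1mul : right_id aut_one aut_mul.
Proof. by move=> u; apply: aut_ext. Qed.

Lemma aut_mulV : left_inverse aut_one aut_inv aut_mul.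
Proof. by move=> u; apply: aut_ext => t /=; rewrite aut_invK. Qed.

Lemma aut_mulVr : right_inverse aut_one aut_inv aut_mul.
Proof. by move=> u; apply: aut_ext => t /=; rewrite aut_invKV. Qed.

(* Automorphisms act on the left: (u * v) t = u (v t). *)
HB.instance Definition _ := isGroup.Build W
  aut_mulA aut_mul1 aut_1mul aut_mulV aut_mulVr.

Lemma edge_sym s t : edge s t = edge t s.
Proof. by apply: eq_existsb => x; rewrite orbC. Qed.

Lemma edge_cons x y s t : edge (x :: s) (y :: t) = (x == y) && edge s t.
Proof.
apply/existsP/andP => [[z]|[/eqP<- /existsP[z st]]].
  rewrite !rcons_cons !eqseq_cons => /orP[] /andP[/eqP-> /eqP->];
  by split=> //; apply/existsP; exists z; rewrite eqxx ?orbT.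
by exists z; rewrite !rcons_cons !eqseq_cons eqxx.
Qed.

Lemma edge_nil_cons y t : edge [::] (y :: t) = (t == [::]).
Proof.
apply/existsP/eqP => [[z]|->]; last by exists y; rewrite /= eqxx.
by rewrite /= orbF eqseq_cons => /andP[_ /eqP].
Qed.

Lemma aut_eq0 (u : W) t : (u t == [::]) = (t == [::]).
Proof. by rewrite -{1}(aut_root u) (inj_eq (bij_inj (aut_bij u))). Qed.

Definition pair_fun (u v : W) (s : word) : word :=
  match s with
  | [::] => [::]
  | false :: t => false :: u t
  | true :: t => true :: v t
  end.

Lemma pair_bij (u v : W) : bijective (pair_fun u v).
Proof.
exists (pair_fun (aut_inv u) (aut_inv v)) => [] [|[] s] //=.
- by rewrite aut_invK.
- by rewrite aut_invK.
- by rewrite aut_invKV.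
- by rewrite aut_invKV.
Qed.

Lemma pair_edge (u v : W) : {mono pair_fun u v : s t / edge s t}.
Proof.
move=> [|x s] [|y t] //.
- by case: y; rewrite /= !edge_nil_cons aut_eq0.
- by rewrite ![edge _ (pair_fun _ _ [::])]edge_sym [RHS]edge_sym; case: x;
    rewrite /= !edge_nil_cons aut_eq0.
- by case: x y => [] []; rewrite /= !edge_cons //= aut_edge.
Qed.

(* The element (u, v) of W. *)
Definition pair_aut (u v : W) : W :=
  @Automorphism (pair_fun u v) (pair_bij u v) erefl (@pair_edge u v).

Definition swap_fun (s : word) : word :=
  if s is x :: t then ~~ x :: t else [::].

Lemma swap_funK : involutive swap_fun.
Proof. by case=> //= x s; rewrite negbK. Qed.

Lemma swap_edge : {mono swap_fun : s t / edge s t}.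
Proof.
move=> [|x s] [|y t] //=; rewrite ?edge_nil_cons ?edge_cons //.
- by rewrite edge_sym edge_nil_cons edge_sym edge_nil_cons.
- by rewrite (inj_eq negb_inj).
Qed.

(* The element sigma of W. *)
Definition swap : W :=
  @Automorphism swap_fun (inv_bij swap_funK) erefl swap_edge.

(* [u] and [v] have the same image in W_n. *)
Definition eq_level (n : nat) (u v : W) : Prop :=
  forall t : word, size t <= n -> u t = v t.

(* The inverse limit topology of the discrete groups W_n. *)
Definition W_open : set (set W) :=
  [set U | forall u, U u -> exists n, forall v, eq_level n u v -> U v].

Lemma W_openT : W_open setT.
Proof. by move=> u _; exists 0. Qed.

Lemma W_openI : setI_closed W_open.
Proof.
move=> U V oU oV u [/oU[m Um] /oV[n Vn]]; exists (maxn m n) => v uv; split.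
- by apply: Um => t tm; apply: uv; rewrite leq_max tm.
- by apply: Vn => t tn; apply: uv; rewrite leq_max tn orbT.
Qed.

Lemma W_open_bigU (I : Type) (U : I -> set W) :
  (forall i, W_open (U i)) -> W_open (\bigcup_i U i).
Proof.
by move=> oU u [i _ /oU[n Un]]; exists n => v /Un Uv; exists i.
Qed.

HB.instance Definition _ :=
  isOpenTopological.Build W W_openT W_openI W_open_bigU.

Definition conjugate (x y : W) : Prop := exists w : W, x = w * y * w^-1.

Definition subgroup_generated (S : set W) : set W :=
  smallest [set H : set W | group_closed [in H]] S.

Definition closed_subgroup_generated (S : set W) : set W :=
  closure (subgroup_generated S).

(* The solution of the recursion, [a_fun false] being a_1 and [a_fun true] being a_2. *)
Fixpoint a_fun (i : bool) (s : word) : word :=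
  match i, s with
  | _, [::] => [::]
  | false, false :: t => true :: t
  | false, true :: t => false :: a_fun true t
  | true, false :: t => false :: a_fun false t
  | true, true :: t => true :: t
  end.

Fixpoint a_inv_fun (i : bool) (s : word) : word :=
  match i, s with
  | _, [::] => [::]
  | false, true :: t => false :: t
  | false, false :: t => true :: a_inv_fun true t
  | true, false :: t => false :: a_inv_fun false t
  | true, true :: t => true :: t
  end.

Lemma a_bij i : bijective (a_fun i).
Proof.
exists (a_inv_fun i) => s; elim: s i => [|x s IH] [] //=; case: x => //=;
  by rewrite IH.
Qed.

Lemma a_root i : a_fun i [::] = [::].
Proof. by case: i. Qed.

Lemma a_fun_eq0 i t : (a_fun i t == [::]) = (t == [::]).
Proof. by rewrite -{1}(a_root i) (inj_eq (bij_inj (a_bij i))). Qed.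

Lemma a_edge i : {mono a_fun i : s t / edge s t}.
Proof.
move=> s; elim: s i => [|x s IH] i [|y t]; rewrite ?a_root //.
- by case: i y => [] []; rewrite /= !edge_nil_cons ?a_fun_eq0.
- rewrite edge_sym [RHS]edge_sym.
  by case: i x => [] []; rewrite /= !edge_nil_cons ?a_fun_eq0.
- by case: i x y => [] [] []; rewrite /= !edge_cons //= IH.
Qed.

Definition a_aut (i : bool) : W :=
  @Automorphism (a_fun i) (a_bij i) (a_root i) (@a_edge i).

Lemma recursion_solution :
  a_aut false = pair_aut (a_aut true) 1 * swap /\
  a_aut true = pair_aut (a_aut false) 1.
Proof. by split; apply: aut_ext => -[|[] t]. Qed.

Lemma recursion_unique (a1 a2 : W) :
  a1 = pair_aut a2 1 * swap /\ a2 = pair_aut a1 1 ->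
  a1 = a_aut false /\ a2 = a_aut true.
Proof.
move=> [e1 e2].
suff H s : a1 s = a_aut false s /\ a2 s = a_aut true s.
  by split; apply: aut_ext => s; case: (H s).
elim: s => [|x s [IH1 IH2]]; first by rewrite !aut_root.
have := congr1 (fun u : W => u (x :: s)) e2.
have := congr1 (fun u : W => u (x :: s)) e1.
by case: x => /= -> ->; rewrite ?IH1 ?IH2.
Qed.

(* Main.v *)
(** Two contraction arguments: a system of equations in W whose right-hand sides,
    on words of length n+1, depend only on the unknowns on words of length n has
    exactly one solution.

    (a) => (b): if b1 = u1 (b2,1) sigma u1^-1 and b2 = u2 (b1,1) u2^-1, solve
    w1 = u1 (w2,w2) and w2 = u2 (w1,1); then the b_i and the w_i a_i w_i^-1 solve
    the same system.

    (b) => (d): this reduces to W = C(a1) C(a2).  Here C(a2) contains C(a1) x W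
    and C(a1) contains a1, which moves 0 to 1, and all (u,u) with u in C(a2).  So
    (p,q) = (u,u) (u^-1 p, u^-1 q) is a suitable factorization as soon as u is in
    C(a2) and u^-1 p is in C(a1), that is, as soon as p^-1 is factored:
    coinduction. *)
Require Import Defs.
From mathcomp Require Import all_boot.
From mathcomp Require Import boolp classical_sets topology.

Set Implicit Arguments.
Unset Strict Implicit.
Unset Printing Implicit Defensive.

Local Open Scope classical_set_scope.
Local Open Scope group_scope.

(** * Multiplication in the wreath product *)

Lemma autM (u v : W) t : (u * v) t = u (v t).
Proof. by []. Qed.

Lemma autK (u : W) : cancel u (u^-1).
Proof. exact: aut_invK. Qed.

Lemma autVK (u : W) : cancel (u^-1) u.
Proof. exact: aut_invKV. Qed.

Lemma pairM (u v u' v' : W) :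
  pair_aut u v * pair_aut u' v' = pair_aut (u * u') (v * v').
Proof. by apply: aut_ext => -[|[] t]. Qed.

Lemma pair1 : pair_aut 1 1 = 1.
Proof. by apply: aut_ext => -[|[] t]. Qed.

Lemma pairV (u v : W) : (pair_aut u v)^-1 = pair_aut u^-1 v^-1.
Proof. by apply: mulg1_eq; rewrite pairM !mulgV pair1. Qed.

Lemma swap_pair (u v : W) : swap * pair_aut u v = pair_aut v u * swap.
Proof. by apply: aut_ext => -[|[] t]. Qed.

(** * Lengths, first letters and sections *)

Lemma aut_rcons (u : W) t x : exists y, u (rcons t x) = rcons (u t) y.
Proof.
have E s y : edge (u s) (u (rcons s y)).
  by rewrite aut_edge; apply/existsP; exists y; rewrite eqxx.
elim/last_ind: t x => [|t z IH] x.
  have /existsP[y /orP[/eqP->|]] := E [::] x; first by exists y.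
  by rewrite aut_root; case: (u _).
have /existsP[y /orP[/eqP->|/eqP]] := E (rcons t z) x; first by exists y.
(* The other neighbour of [u (rcons t z)], its parent, is [u t], a value that injectivity reserves
   for [t]. *)
have [z' ->] := IH z => /rcons_inj[/(bij_inj (aut_bij u)) /(congr1 size)].
by rewrite !size_rcons => /eqP; rewrite ltn_eqF.
Qed.

Lemma size_aut (u : W) t : size (u t) = size t.
Proof.
elim/last_ind: t => [|t x IH]; first by rewrite aut_root.
by have [y ->] := aut_rcons u t x; rewrite !size_rcons IH.
Qed.

(** The default of [head] is never met, since [u [:: x]] has length one. *)
Definition first_letter (u : W) (x : bool) : bool := head false (u [:: x]).

Definition section_fun (u : W) (x : bool) (t : word) : word := behead (u (x :: t)).

(** Appending letters to a word only appends letters to its image, so the head of [u (x :: t)]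
    depends on [x] alone. *)
Lemma aut_cons (u : W) x t : u (x :: t) = first_letter u x :: section_fun u x t.
Proof.
rewrite /section_fun; suff <- : head false (u (x :: t)) = first_letter u x.
  by move: (size_aut u (x :: t)); case: (u _).
elim/last_ind: t => // t y <-.
have [z] := aut_rcons u (x :: t) y; rewrite rcons_cons => ->.
by move: (size_aut u (x :: t)); case: (u _).
Qed.

Lemma section_funK (u : W) x :
  cancel (section_fun u x) (section_fun u^-1 (first_letter u x)).
Proof. by move=> t; rewrite {1}/section_fun -aut_cons autK. Qed.

Lemma section_bij (u : W) x : bijective (section_fun u x).
Proof.
exists (section_fun u^-1 (first_letter u x)); first exact: section_funK.
(* The other cancellation is [section_funK] for [u^-1] at the letter to which [u] sends [x]. *)
have -> : section_fun u x =
    section_fun (u^-1)^-1 (first_letter u^-1 (first_letter u x)).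
  rewrite invgK; congr section_fun.
  by have := autK u [:: x]; rewrite aut_cons aut_cons => -[].
exact: section_funK.
Qed.

Lemma section_root (u : W) x : section_fun u x [::] = [::].
Proof. by have := size_aut u [:: x]; rewrite aut_cons => -[] /size0nil. Qed.

Lemma section_edge (u : W) x : {mono section_fun u x : s t / edge s t}.
Proof.
move=> s t; have := aut_edge u (x :: s) (x :: t).
by rewrite !aut_cons !edge_cons !eqxx.
Qed.

Definition section (u : W) (x : bool) : W :=
  Automorphism (section_bij u x) (section_root u x) (@section_edge u x).

Lemma first_letter_inj (u : W) : injective (first_letter u).
Proof.
move=> x y xy; have : u [:: x] = u [:: y].
  by rewrite !aut_cons !section_root xy.
by move/(bij_inj (aut_bij u)) => -[].
Qed.

Lemma pair_section (u : W) :
  ~~ first_letter u false -> u = pair_aut (section u false) (section u true).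
Proof.
move=> u0; have u1 : first_letter u true.
  apply: contraT => /negbTE u1.
  by have /first_letter_inj : first_letter u true = first_letter u false
    by rewrite u1 (negbTE u0).
by apply: aut_ext => -[|[] t]; rewrite ?aut_root // aut_cons ?u1 ?(negbTE u0).
Qed.

(** * Agreement up to a level, and limits *)

Lemma eq_level_sym n (u v : W) : eq_level n u v -> eq_level n v u.
Proof. by move=> uv t tn; rewrite uv. Qed.

Lemma eq_level_trans n (u v w : W) :
  eq_level n u v -> eq_level n v w -> eq_level n u w.
Proof. by move=> uv vw t tn; rewrite uv ?vw. Qed.

Lemma eq_level0 (u v : W) : eq_level 0 u v.
Proof. by case=> // _; rewrite !aut_root. Qed.

Lemma eq_levelW n (u v : W) : eq_level n.+1 u v -> eq_level n u v.
Proof. by move=> uv t tn; rewrite uv // leqW. Qed.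

Lemma eq_level_ext (u v : W) : (forall n, eq_level n u v) -> u = v.
Proof. by move=> uv; apply: aut_ext => t; apply: (uv (size t)). Qed.

Lemma eq_levelM n (u u' v v' : W) :
  eq_level n u u' -> eq_level n v v' -> eq_level n (u * v) (u' * v').
Proof. by move=> uu vv t tn; rewrite !autM vv ?uu ?size_aut. Qed.

Lemma eq_level_pair n (u u' v v' : W) : eq_level n u u' -> eq_level n v v' ->
  eq_level n.+1 (pair_aut u v) (pair_aut u' v').
Proof. by move=> uu vv [|[] t] //= tn; rewrite ?uu ?vv. Qed.

(** Completeness of W: the limit and its inverse act on words of length n as the n-th term and its
    inverse do, which is consistent because lengths are preserved. *)
Lemma eq_level_lim (w : nat -> W) :
  (forall n, eq_level n (w n) (w n.+1)) ->
  exists u, forall n, eq_level n (w n) u.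
Proof.
move=> wS; have wE m n t : size t <= m <= n -> w m t = w n t.
  case/andP=> tm /subnK <-; elim: (n - m) => // k ->.
  by rewrite addSn wS // (leq_trans tm) // leq_addl.
pose f t := w (size t) t; pose g t := (w (size t))^-1 t.
have fK : cancel f g by move=> t; rewrite /g /f size_aut autK.
have gK : cancel g f by move=> t; rewrite /g /f size_aut autVK.
have f0 : f [::] = [::] by rewrite /f aut_root.
have fe : {mono f : s t / edge s t}.
  move=> s t; rewrite /f.
  rewrite (wE _ (maxn (size s) (size t))) ?leqnn ?leq_maxl //.
  by rewrite (wE (size t) (maxn (size s) (size t))) ?leqnn ?leq_maxr // aut_edge.
exists (Automorphism (Bijective fK gK) f0 fe) => n t tn /=.
by rewrite /f (wE _ n) ?leqnn.
Qed.

(** * Fixed points of contracting systems *)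

Definition contracting (I : Type) (Phi : (I -> W) -> I -> W) : Prop :=
  forall n F F', (forall i, eq_level n (F i) (F' i)) ->
  forall i, eq_level n.+1 (Phi F i) (Phi F' i).

Lemma contracting_fixpoint (I : Type) (Phi : (I -> W) -> I -> W) :
  contracting Phi -> exists F, forall i, F i = Phi F i.
Proof.
move=> cPhi; pose w n := iter n Phi (fun=> 1).
have wS n : forall i, eq_level n (w n i) (w n.+1 i).
  by elim: n => [i|n IH]; [apply: eq_level0 | apply: cPhi].
have /choice[F wF] i := eq_level_lim (fun n => wS n i).
(* [F] agrees with [w n.+1], that is [Phi (w n)], up to level n+1, and this agrees with [Phi F] up
   to the same level by contraction. *)
exists F => i; apply: eq_level_ext => n; apply: eq_levelW.
apply: (eq_level_trans (eq_level_sym (wF i n.+1))).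
by apply: cPhi => j; apply: wF.
Qed.

Lemma contracting_fixpoint_unique (I : Type) (Phi : (I -> W) -> I -> W) F F' :
  contracting Phi -> (forall i, F i = Phi F i) -> (forall i, F' i = Phi F' i) ->
  forall i, F i = F' i.
Proof.
move=> cPhi FE F'E i; apply: eq_level_ext => n.
elim: n i => [|n IH] i; first exact: eq_level0.
by rewrite FE F'E; apply: cPhi.
Qed.

(** * Conjugators from the recursion *)

Lemma conjugate_of_recursion (a1 a2 b1 b2 : W) :
  a1 = pair_aut a2 1 * swap -> a2 = pair_aut a1 1 ->
  conjugate b1 (pair_aut b2 1 * swap) -> conjugate b2 (pair_aut b1 1) ->
  conjugate b1 a1 /\ conjugate b2 a2.
Proof.
move=> ha1 ha2 [u1 hb1] [u2 hb2].
pose Phi (w : bool -> W) i :=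
  if i then u2 * pair_aut (w false) 1 else u1 * pair_aut (w true) (w true).
have [|w wE] := @contracting_fixpoint _ Phi.
  by move=> n F F' FF' []; apply: eq_levelM => //; apply: eq_level_pair.
pose Psi (b : bool -> W) i :=
  if i then u2 * pair_aut (b false) 1 * u2^-1
  else u1 * (pair_aut (b true) 1 * swap) * u1^-1.
have cPsi : contracting Psi.
  by move=> n F F' FF' []; do !apply: eq_levelM => //; apply: eq_level_pair.
pose a i := if i then a2 else a1; pose b i := if i then b2 else b1.
have bE : forall i, b i = w i * a i * (w i)^-1.
  apply: (contracting_fixpoint_unique cPsi) => -[] //.
    rewrite {1 2}wE /Psi /= {1}ha2 invgM !mulgA; congr (_ * _).
    by rewrite -!mulgA pairV !pairM invg1 !mulg1.
  (* The two coordinates of [(w2,w2)] are equal so that it commutes with sigma: conjugating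
     [(a2,1) sigma] by it gives [(w2 a2 w2^-1, 1) sigma]. *)
  rewrite {1 2}wE /Psi /= {1}ha1 invgM !mulgA; congr (_ * _).
  rewrite -!mulgA pairV swap_pair !mulgA; congr (_ * _).
  by rewrite -!mulgA !pairM mul1g mulgV !mulgA.
by split; [exists (w false); apply: (bE false) | exists (w true); apply: (bE true)].
Qed.

(** * Factorization through the two centralizers *)

Definition commute_level n (u v : W) : Prop := eq_level n (u * v) (v * u).

Lemma commute_levelV n (u v : W) : commute_level n u v -> commute_level n u^-1 v.
Proof.
move=> uv; rewrite /commute_level.
have -> : u^-1 * v = u^-1 * (v * u) * u^-1 by rewrite !mulgA mulgK.
have -> : v * u^-1 = u^-1 * (u * v) * u^-1 by rewrite mulKg.
by apply: eq_levelM => //; apply: eq_levelM => //; apply: eq_level_sym.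
Qed.

Lemma centralizer_factorization (a1 a2 : W) :
  a1 = pair_aut a2 1 * swap -> a2 = pair_aut a1 1 ->
  forall x : W, exists f g : W, [/\ x = f * g, commute f a1 & commute g a2].
Proof.
move=> ha1 ha2.
(* [c x] centralizes [a1] and acts on the first level as [x] does, so [(c x)^-1 * x] is a pair
   [(p x, q x)]. *)
pose c (x : W) := if first_letter x false then a1 else 1.
pose p (x : W) := section ((c x)^-1 * x) false.
pose q (x : W) := section ((c x)^-1 * x) true.
have xE x : x = c x * pair_aut (p x) (q x).
  rewrite -pair_section ?mulVKg // /c.
  case x0: (first_letter x false); last by rewrite invg1 mul1g x0.
  apply/negP => y0; move: x0; rewrite /first_letter -(mulVKg a1 x) autM.
  by rewrite (aut_cons (a1^-1 * x)) y0 section_root {1}ha1.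
have ca1 x : commute (c x) a1.
  by rewrite /c; case: ifP => _; [apply: commute_refl | apply/commute_sym/commute1].
(* One system with an unknown [F x], the factor in C(a1), for every x in W. The entry
   [p x * F (p x)^-1] is the inverse of the C(a2)-factor of [(p x)^-1]. *)
pose Phi (F : W -> W) x :=
  c x * pair_aut (p x * F (p x)^-1) (p x * F (p x)^-1).
have [|F FE] := @contracting_fixpoint _ Phi.
  move=> n F F' FF' x; apply: eq_levelM => //.
  by apply: eq_level_pair; apply: eq_levelM.
pose g x := (F x)^-1 * x.
have gE x : g x = pair_aut (F (p x)^-1)^-1 ((p x * F (p x)^-1)^-1 * q x).
  rewrite /g {2}(xE x) FE /Phi invgM -mulgA mulKg pairV pairM.
  by rewrite invgM mulgVK.
(* The two claims feed each other: at level n+1 for [x], each uses the other's factor of [(p x)^-1]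
   or its own at level n, and passing to pairs gains the level. *)
have Fg n x : commute_level n (F x) a1 /\ commute_level n (g x) a2.
  elim: n x => [|n IH] x; first by split; apply: eq_level0.
  have [IHF IHg] := IH (p x)^-1; split; last first.
    rewrite gE ha2 /commute_level !pairM mulg1 mul1g.
    by apply: eq_level_pair => //; apply: commute_levelV.
  set u := p x * F (p x)^-1.
  have ua2 : commute_level n u a2.
    have -> : u = (g (p x)^-1)^-1 by rewrite /g invgM !invgK.
    exact: commute_levelV.
  rewrite /commute_level FE /Phi -/u mulgA -ca1 -!mulgA; apply: eq_levelM => //.
  rewrite {1 2}ha1 -mulgA swap_pair !mulgA !pairM mulg1 mul1g.
  by apply: eq_levelM => //; apply: eq_level_pair.
move=> x; exists (F x), (g x); split; first by rewrite mulVKg.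
  by apply: eq_level_ext => n; have [] := Fg n x.
by apply: eq_level_ext => n; have [] := Fg n x.
Qed.

Lemma simultaneous_conjugate (a1 a2 b1 b2 : W) :
  a1 = pair_aut a2 1 * swap -> a2 = pair_aut a1 1 ->
  conjugate b1 a1 -> conjugate b2 a2 ->
  exists w : W, b1 = w * a1 * w^-1 /\ b2 = w * a2 * w^-1.
Proof.
move=> ha1 ha2 [w1 ->] [w2 ->].
have [f [g [fg fa1 ga2]]] := centralizer_factorization ha1 ha2 (w1^-1 * w2).
(* Since [w1 * f = w2 * g^-1], this element conjugates [a1] as [w1] does and [a2] as [w2] does. *)
exists (w1 * f); split.
  by rewrite invgM -!mulgA (mulgA f) fa1 -mulgA mulVKg.
have -> : w1 * f = w2 * g^-1 by rewrite -(mulVKg w1 w2) fg mulgA mulgK.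
by rewrite invgM invgK -!mulgA (mulgA a2) -ga2 -!mulgA mulKg.
Qed.

(** * The cycle of implications *)

Lemma one_in_closed_subgroup (S : set W) : closed_subgroup_generated S 1.
Proof. by apply: subset_closure => H [[H1 _] _]; rewrite inE in H1. Qed.

Theorem theorem2p5p6 (a1 a2 : W)
    (ha1 : a1 = pair_aut a2 1 * swap) (ha2 : a2 = pair_aut a1 1)
    (b1 b2 : W) :
  let G := closed_subgroup_generated [set a1; a2] in
  [<-> (* a *) conjugate b1 (pair_aut b2 1 * swap) /\
               conjugate b2 (pair_aut b1 1);
       (* b *) conjugate b1 a1 /\ conjugate b2 a2;
       (* c *) exists w x1 x2 : W, [/\ G x1, G x2,
                 b1 = (w * x1) * a1 * (w * x1)^-1 &
                 b2 = (w * x2) * a2 * (w * x2)^-1];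
       (* d *) exists w : W, b1 = w * a1 * w^-1 /\ b2 = w * a2 * w^-1].
Proof.
move=> G; tfae.
- by move=> [hb1 hb2]; apply: conjugate_of_recursion.
- move=> [hb1 hb2]; have [w [-> ->]] := simultaneous_conjugate ha1 ha2 hb1 hb2.
  by exists w, 1, 1; split; rewrite ?mulg1 //; apply: one_in_closed_subgroup.
- move=> [w [x1 [x2 [_ _ hb1 hb2]]]].
  apply: simultaneous_conjugate => //.
    by exists (w * x1).
  by exists (w * x2).
- move=> [w [-> ->]]; split.
    (* With [b2 = w a2 w^-1], the element [(b2,1) sigma] is the conjugate of [a1] by [(w,w)];
       likewise below, [(b1,1)] is that of [a2] by [(w,1)]. *)
    exists (w * pair_aut w^-1 w^-1).
    rewrite {1}ha1 invgM pairV !invgK -!mulgA; congr (_ * _).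
    rewrite !mulgA -2![_ * swap * _]mulgA swap_pair !mulgA !pairM.
    by rewrite !mulgA mulVg mul1g mulgVK mulg1 mulVg.
  exists (w * pair_aut w^-1 1).
  rewrite {1}ha2 invgM pairV !invgK invg1 -!mulgA; congr (_ * _).
  by rewrite !mulgA !pairM !mulgA mulVg mul1g mulgVK !mulg1.
Qed.
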